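(* For all integers $k\ge3$, $$\sup_{(X,Y)\in\mathcal C_{\mathcal I}}\mathbb E|X-Y|^{k}\le\int_0^{1/2}kt^{k-1}\,\mathrm dt+\int_{1/2}^{1}kt^{k-1}\cdot 2t(1-t)\,\mathrm dt,$$ that is, $$\sup_{(X,Y)\in\mathcal C_{\mathcal I}}\mathbb E|X-Y|^{k}\le 2\cdot\frac{k}{(k+1)(k+2)}+2^{-k}-2^{-k-1}\cdot\frac{k(k+3)}{(k+1)(k+2)}.$$
   Context: A pair $(X,Y)$ of random variables on a common probability space $(\Omega,\mathcal F,\mathbb P)$ is called coherent if there exist an event $A\in\mathcal F$ and sub-$\sigma$-fields $\mathcal G,\mathcal H\subset\mathcal F$ such that $X=\mathbb P(A|\mathcal G)$ and $Y=\mathbb P(A|\mathcal H)$. $\mathcal C_{\mathcal I}$ denotes the family of all coherent pairs $(X,Y)$ (over all probability spaces, events and sub-$\sigma$-fields) with $X$ and $Y$ independent. *)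

(* Defs.v *)
From mathcomp Require Import all_boot all_order all_algebra.
From mathcomp Require Import all_classical all_reals all_analysis.

Set Implicit Arguments.
Unset Strict Implicit.
Unset Printing Implicit Defensive.

Import Order.TTheory GRing.Theory Num.Theory.
Import numFieldNormedType.Exports.

Local Open Scope classical_set_scope.
Local Open Scope ring_scope.
Local Open Scope ereal_scope.

Definition sub_sigma_field (d : measure_display) (T : measurableType d)
    (G : set_system T) : Prop :=
  sigma_algebra [set: T] G /\ G `<=` measurable.

(* Conditional probabilities are only determined up to P-null sets, so
   "X = P(A | G)" is the relation "X is a version of P(A | G)". *)
Definition is_cond_prob (d : measure_display) (T : measurableType d)
    (R : realType) (P : probability T R) (A : set T) (G : set_system T)
    (X : {RV P >-> R}) : Prop :=
  [/\ forall B : set R, measurable B -> G (X @^-1` B),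
      P.-integrable [set: T] (EFin \o X) &
      forall B : set T, G B -> \int[P]_(w in B) (X w)%:E = P (A `&` B)].

Definition coherent (d : measure_display) (T : measurableType d)
    (R : realType) (P : probability T R) (X Y : {RV P >-> R}) : Prop :=
  exists (A : set T) (G H : set_system T),
    [/\ measurable A, sub_sigma_field G, sub_sigma_field H,
        is_cond_prob A G X & is_cond_prob A H Y].

Definition independent_RV2 (d : measure_display) (T : measurableType d)
    (R : realType) (P : probability T R) (X Y : {RV P >-> R}) : Prop :=
  forall B C : set R, measurable B -> measurable C ->
    P (X @^-1` B `&` Y @^-1` C) = P (X @^-1` B) * P (Y @^-1` C).

(* Membership of (X, Y) in the family C_I, for a fixed probability space;
   quantifying over all probability spaces is left to the user. *)
Definition coherent_independent (d : measure_display) (T : measurableType d)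
    (R : realType) (P : probability T R) (X Y : {RV P >-> R}) : Prop :=
  coherent X Y /\ independent_RV2 X Y.

(* The supremum over C_I is taken over this set of values: it collects
   E|X - Y|^k over all probability spaces (T, P). *)
Definition coherent_independent_moments (R : realType) (k : nat) :
    set (\bar R) :=
  [set m | exists (d : measure_display) (T : measurableType d)
             (P : probability T R) (X Y : {RV P >-> R}),
             coherent_independent X Y /\
             m = 'E_P[fun w => (`|X w - Y w| ^+ k)%R]].
Arguments coherent_independent_moments : clear implicits.

(* Main.v *)
(** By the layer-cake formula it suffices to bound P(|X - Y| >= t) by
    2t(1 - t) for 1/2 < t <= 1. Put b = 1 - t and write p(s) = P(X >= t + s),
    q(s) = P(Y <= s). Since X and Y take their values in [0, 1] almost surely,
    {X - Y >= t} is contained in {X >= t, Y <= b}, whence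
    P(X - Y >= t) <= p(0) q(b).

    Moreover P(X - Y >= t) <= b max(p(0), q(b)), the only nontrivial case
    being p(0), q(b) > b. As {X >= t, Y <= b} is contained in
    ({X >= t} \ A) u ({Y <= b} n A), coherence and independence give
    p(0) q(b) <= E[(1 - X) 1_{X >= t}] + E[Y 1_{Y <= b}]
              = b (p(0) + q(b)) - E(X - t)^+ - E(b - Y)^+,
    so that the integral of p + q over [0, b], which is
    E(X - t)^+ + E(b - Y)^+, is at most b^2 - (p(0) - b)(q(b) - b) < b^2; hence
    p(s) + P(Y < s) < b for some s in [0, b]. Finally {X - Y >= t} lies in
    {X >= t, Y < s} u {X >= t + s, Y <= b}, and one uses independence.

    The same bounds hold for Y - X; since t > 1/2, P(X >= t) + P(X <= b) <= 1
    and P(Y >= t) + P(Y <= b) <= 1, and under these constraints the two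
    one-sided bounds add up to at most 2tb. *)

Require Import Defs.
From mathcomp Require Import all_boot all_order all_algebra.
From mathcomp Require Import all_classical all_reals all_analysis.
From mathcomp Require Import measurable_realfun lra ring.

Import Order.TTheory GRing.Theory Num.Theory.
Import numFieldNormedType.Exports.

Local Open Scope classical_set_scope.
Local Open Scope ring_scope.
Local Open Scope ereal_scope.

(** * Measurability, truncation and the layer-cake formula *)

Lemma measurable_RV_preimage {d : measure_display} {T : measurableType d}
    {R : realType} {P : probability T R} (X : {RV P >-> R}) (B : set R) :
  measurable B -> measurable (X @^-1` B).
Proof.
by move=> mB; rewrite -[X in measurable X]setTI; exact: measurable_funPT.
Qed.

Lemma measurable_ge_set {d : measure_display} {T : measurableType d}
    {R : realType} {f : T -> R} (t : R) :
  measurable_fun [set: T] f -> measurable [set w | (t <= f w)%R].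
Proof.
by move=> mf; rewrite -[X in measurable X]setTI; exact: measurable_fun_le.
Qed.

(** Truncation keeps integrands bounded, hence integrable, and confines layer-cake integrals to a
    compact interval. For X and Y valued in [0, 1] and b = 1 - t >= 0, [clamp 0 b (X - t)] is the
    positive part of X - t, and [b - clamp 0 b Y] that of b - Y. *)
Definition clamp {R : realType} (a b x : R) : R := Num.max a (Num.min b x).

Lemma integral_deriv_poly {R : realType} (p : {poly R}) (a b : R) :
  (a <= b)%R ->
  \int[lebesgue_measure]_(x in `[a, b]) ((p^`()).[x])%:E = (p.[b] - p.[a])%:E.
Proof.
rewrite le_eqVlt => /predU1P[<-|ab].
  by rewrite set_itv1 integral_set1 subrr.
rewrite (@continuous_FTC2 _ _ (horner p)) ?EFinB//.
- by apply: continuous_subspaceT => x; exact: continuous_horner.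
- split=> [x _| |]; first exact: derivable_horner.
  + by apply: cvg_at_right_filter; exact: continuous_horner.
  + by apply: cvg_at_left_filter; exact: continuous_horner.
- by move=> x _; rewrite derivE.
Qed.

(** The increment of p is the integral of p' over those t in [a, b] with t <= Z(w); as p' >= 0
    there, Tonelli exchanges this integral with the one over w. It serves for p = X (truncated
    expectations) and for p = X^k (the moment). *)
Lemma layer_cake_poly {d : measure_display} {T : measurableType d}
    {R : realType} (P : probability T R) (Z : T -> R) (p : {poly R}) (a b : R) :
  measurable_fun [set: T] Z -> (a <= b)%R ->
  (forall x : R, a <= x <= b -> 0 <= (p^`()).[x])%R ->
  \int[P]_w (p.[clamp a b (Z w)] - p.[a])%:E =
  \int[lebesgue_measure]_(t in `[a, b])
    (((p^`()).[t])%:E * P [set w | (t <= Z w)%R]).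
Proof.
move=> mZ ab p0.
pose GR := measurableTypeR R.
pose E : set (T * GR) := [set u | (a <= u.2 <= b)%R && (u.2 <= Z u.1)%R].
pose f (u : T * GR) : \bar R := ((p^`()).[u.2] * \1_E u)%:E.
have mE : measurable E.
  rewrite [X in measurable X](_ : _ =
      (fun u : T * GR => [&& a <= u.2, u.2 <= b & u.2 <= Z u.1]%R)
        @^-1` [set true]).
    rewrite -[X in measurable X]setTI.
    apply: (@measurable_and _ _ setT _ _) => //.
      exact: measurable_fun_ler.
    apply: measurable_and.
      exact: measurable_fun_ler.
    apply: measurable_fun_ler => //.
    exact: measurableT_comp.
  by apply/seteqP; split=> u; rewrite /E/= -andbA.
have mf : measurable_fun setT f.
  apply/measurable_EFinP; apply: measurable_funM.
    by apply: measurableT_comp => //; exact: measurable_poly.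
  exact: measurable_indic.
have f0 u : 0 <= f u.
  rewrite lee_fin /f indicE.
  case: (boolP (u \in E)) => [|_]; last by rewrite mulr0.
  by rewrite inE /E/= mulr1 => /andP[/p0].
transitivity (\int[P]_w \int[@lebesgue_measure R]_t f (w, t)).
  apply: eq_integral => w _.
  (* The slice of [E] at w is the interval from a to min(b, Z w), which is empty when Z w < a; then
     the clamp equals a and both sides vanish. *)
  have [aZ|Za] := leP a (Z w).
    have aM : (a <= Num.min b (Z w))%R by rewrite le_min ab.
    rewrite /clamp max_r// -integral_deriv_poly// integral_mkcond.
    apply: eq_integral => t _; rewrite /f patchE indicE.
    rewrite (_ : ((w, t) \in E) = (t \in `[a, Num.min b (Z w)]%classic)).
      by case: ifP; rewrite ?mulr1 ?mulr0.
    by apply/idP/idP; rewrite !inE /E/= in_itv/= le_min andbA.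
  rewrite /clamp max_l ?subrr; last by rewrite ge_min (ltW Za) orbT.
  rewrite integral0_eq// => t _; rewrite /f indicE memNset ?mulr0// /E/=.
  by move=> /andP[/andP[/(lt_le_trans Za)/lt_geF ->]].
rewrite fubini_tonelli// [RHS]integral_mkcond.
apply: eq_integral => t _; rewrite patchE.
case: ifPn => [|tab]; last first.
  rewrite integral0_eq// => w _; rewrite /f indicE memNset ?mulr0//.
  by rewrite /E/= => /andP[h _]; move: tab; rewrite notin_setE/= in_itv/= h.
rewrite inE/= in_itv/= => tab.
transitivity (\int[P]_w (((p^`()).[t])%:E * (\1_[set w | (t <= Z w)%R] w)%:E)).
  apply: eq_integral => w _; rewrite /f -EFinM !indicE; congr (_ * _%:R)%:E.
  by congr nat_of_bool; apply/idP/idP; rewrite !inE /E/= tab.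
have mt := measurable_ge_set t mZ.
rewrite ge0_integralZl ?integral_indic ?setIT//.
- by apply/measurable_EFinP; exact: measurable_indic.
- by rewrite lee_fin p0.
Qed.

(** * Conditional probabilities: range, tails and the rectangle bound *)

Lemma null_set_integral_le0 {d : measure_display} {T : measurableType d}
    {R : realType} (mu : {measure set T -> \bar R}) (N : set T) (f : T -> R) :
  measurable N -> mu.-integrable N (EFin \o f) ->
  (forall w, N w -> 0 < f w)%R -> \int[mu]_(w in N) (f w)%:E <= 0 ->
  mu N = 0.
Proof.
move=> mN fN f0 fle.
have mf := measurable_int _ fN.
have : \int[mu]_(w in N) `|(f w)%:E| = 0.
  apply/eqP; rewrite eq_le integral_ge0// andbT.
  rewrite (eq_integral (fun w => (f w)%:E))// => w /[!inE] /f0 fw.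
  by rewrite gee0_abs ?lee_fin ?ltW.
move=> /(ae_eq_integral_abs mu mN mf) N0.
apply: measure_negligible => //; apply: negligibleS N0 => w Nw /= /(_ Nw).
by move=> [] fw0; have := f0 w Nw; rewrite fw0 ltxx.
Qed.

(** The events X < 0 and X > 1 belong to G, so the defining identity applies to them: -X and X - 1,
    positive on the respective event, have integrals -P(A n {X < 0}) <= 0 and P(A n {X > 1}) - P(X >
    1) <= 0. Both events are therefore null. *)
Lemma cond_prob_ge0_le1 {d : measure_display} {T : measurableType d}
    {R : realType} {P : probability T R} {A : set T} {G : set_system T}
    {X : {RV P >-> R}} :
  measurable A -> is_cond_prob A G X ->
  {ae P, forall w, 0 <= X w <= 1}%R.
Proof.
move=> mA [GX iX XA].
have mX := measurable_RV_preimage X.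
have iXS (N : set T) : measurable N -> P.-integrable N (EFin \o X).
  by move=> mN; exact: integrableS iX.
have neg0 : P (X @^-1` `]-oo, 0%R[) = 0.
  have mI : measurable (`]-oo, 0%R[%classic : set R) by exact: measurable_itv.
  have mN := mX _ mI; have iN := iXS _ mN; have eN := XA _ (GX _ mI).
  apply: (@null_set_integral_le0 _ _ _ _ _ (fun w => - X w)%R) => //.
  - exact: integrableN iN.
  - by move=> w /=; rewrite in_itv/= oppr_gt0.
  - have -> : \int[P]_(w in X @^-1` `]-oo, 0%R[) (- X w)%:E =
              - \int[P]_(w in X @^-1` `]-oo, 0%R[) (X w)%:E.
      by rewrite -integralN//; apply: integrable_add_def iN.
    by rewrite eN leeNl oppe0.
have gt1 : P (X @^-1` `]1%R, +oo[) = 0.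
  have mI : measurable (`]1%R, +oo[%classic : set R) by exact: measurable_itv.
  have mN := mX _ mI; have iN := iXS _ mN; have eN := XA _ (GX _ mI).
  have i1 : P.-integrable (X @^-1` `]1%R, +oo[) (EFin \o cst 1%R).
    exact: finite_measure_integrable_cst.
  apply: (@null_set_integral_le0 _ _ _ _ _ (fun w => X w - 1)%R) => //.
  - by have := integrableB mN iN i1; exact.
  - by move=> w /=; rewrite in_itv/= andbT subr_gt0.
  - have -> : \int[P]_(w in X @^-1` `]1%R, +oo[) (X w - 1)%:E =
              \int[P]_(w in X @^-1` `]1%R, +oo[) (X w)%:E -
              \int[P]_(w in X @^-1` `]1%R, +oo[) (1%R)%:E.
      by rewrite -integralB_EFin.
    rewrite eN integral_cst// mul1e.
    rewrite leeBlDr ?fin_num_measure// add0e le_measure ?inE//.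
    exact: measurableI.
have n0 : P.-negligible (X @^-1` `]-oo, 0%R[).
  by apply/negligibleP => //; exact: mX.
have n1 : P.-negligible (X @^-1` `]1%R, +oo[).
  by apply/negligibleP => //; exact: mX.
apply: negligibleS (negligibleU n0 n1) => w /= /negP.
by rewrite negb_and -!ltNge !in_itv/= andbT => /orP.
Qed.

Lemma measurable_clamp {d : measure_display} {T : measurableType d}
    {R : realType} (a b : R) (f : T -> R) :
  measurable_fun [set: T] f ->
  measurable_fun [set: T] (fun w => clamp a b (f w)).
Proof.
by move=> mf; apply: measurable_maxr => //; exact: measurable_minr.
Qed.

Lemma clamp_itv {R : realType} (a b x : R) :
  (a <= b)%R -> (a <= clamp a b x <= b)%R.
Proof.
by move=> ab; rewrite /clamp le_max lexx/= ge_max ab/= ge_min lexx.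
Qed.

Lemma integrable_clamp {d : measure_display} {T : measurableType d}
    {R : realType} (P : probability T R) (a b : R) (f : T -> R) :
  (a <= b)%R -> measurable_fun [set: T] f ->
  P.-integrable [set: T] (EFin \o (fun w => clamp a b (f w))).
Proof.
move=> ab mf.
apply: (le_integrable measurableT _ _
  (finite_measure_integrable_cst P (`|a| + `|b|)%R measurableT)) => /=.
  by apply/measurable_EFinP; exact: measurable_clamp.
move=> w _; rewrite lee_fin.
have /andP[] := clamp_itv a b (f w) ab.
rewrite (ger0_norm (addr_ge0 _ _))// ler_norml => h1 h2.
have := ler_norm b; have := lerNnormlW (lexx `|a|%R).
have := normr_ge0 a; have := normr_ge0 b => b0 a0 a1 b1.
by apply/andP; split; lra.
Qed.

(** Since {X >= t} lies in G, the right-hand side is E[(X - t) 1_{X >= t}], whose integrand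
    dominates the truncation pointwise. *)
Lemma cond_prob_upper_tail {d : measure_display} {T : measurableType d}
    {R : realType} {P : probability T R} {A : set T} {G : set_system T}
    {X : {RV P >-> R}} (b t : R) :
  is_cond_prob A G X -> (0 <= b)%R ->
  (\int[P]_w clamp 0 b (X w - t) <=
   fine (P (A `&` X @^-1` `[t, +oo[)) - t * fine (P (X @^-1` `[t, +oo[)))%R.
Proof.
move=> [GX iX XA] b0; set H := X @^-1` _.
have mI : measurable (`[t, +oo[%classic : set R) by exact: measurable_itv.
have mH : measurable H by exact: measurable_RV_preimage.
have eH := XA _ (GX _ mI).
have iH : P.-integrable H (EFin \o X) by exact: integrableS iX.
have it : P.-integrable H (EFin \o cst t).
  exact: finite_measure_integrable_cst.
have iXt : P.-integrable H (EFin \o (fun w => X w - t)%R).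
  by have := integrableB mH iH it; exact.
have -> : (fine (P (A `&` H)) - t * fine (P H) =
    \int[P]_(w in H) (X w - t))%R.
  by rewrite RintegralB// Rintegral_cst// /Rintegral eH.
rewrite [leRHS]Rintegral_mkcond; apply: le_Rintegral => //.
- by apply: integrable_clamp => //; exact: measurable_funB.
- by rewrite -restrict_EFin; apply/integrable_restrict => //; rewrite setTI.
- move=> w _; rewrite patchE /clamp; case: ifPn.
    rewrite inE /H/= in_itv/= andbT => Xt.
    by rewrite ge_max subr_ge0 Xt ge_min lexx orbT.
  rewrite notin_setE /H/= in_itv/= andbT => /negP; rewrite -ltNge => Xt.
  by rewrite ge_max lexx/= ge_min subr_le0 (ltW Xt) orbT.
Qed.

(** The right-hand side is E[(b - Y) 1_{Y <= b}], and the truncation of Y is at least Y where Y <= b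
    and equals b elsewhere. *)
Lemma cond_prob_lower_tail {d : measure_display} {T : measurableType d}
    {R : realType} {P : probability T R} {A : set T} {G : set_system T}
    {Y : {RV P >-> R}} (b : R) :
  is_cond_prob A G Y -> (0 <= b)%R ->
  (b - \int[P]_w clamp 0 b (Y w) <=
   b * fine (P (Y @^-1` `]-oo, b])) - fine (P (A `&` Y @^-1` `]-oo, b])))%R.
Proof.
move=> [GY iY YA] b0; set L := Y @^-1` _.
have mI : measurable (`]-oo, b]%classic : set R) by exact: measurable_itv.
have mL : measurable L by exact: measurable_RV_preimage.
have eL := YA _ (GY _ mI).
have iL : P.-integrable L (EFin \o Y) by exact: integrableS iY.
have ib (D : set T) : measurable D -> P.-integrable D (EFin \o cst b).
  by move=> mD; exact: finite_measure_integrable_cst.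
have ibY : P.-integrable L (EFin \o (fun w => b - Y w)%R).
  by have := integrableB mL (ib _ mL) iL; exact.
have iC : P.-integrable [set: T] (EFin \o (fun w => clamp 0 b (Y w))).
  exact: integrable_clamp.
have -> : (b * fine (P L) - fine (P (A `&` L)) = \int[P]_(w in L) (b - Y w))%R.
  by rewrite RintegralB ?Rintegral_cst// ?/Rintegral ?eL//; exact: ib.
have -> : (b - \int[P]_w clamp 0 b (Y w) = \int[P]_w (b - clamp 0 b (Y w)))%R.
  rewrite RintegralB ?Rintegral_cst//; last exact: ib.
  rewrite (_ : fine _ = 1%R) ?mulr1//.
  by rewrite -[RHS]/(fine 1); congr fine; exact: probability_setT.
rewrite [leRHS]Rintegral_mkcond; apply: le_Rintegral => //.
- by have := integrableB measurableT (ib _ measurableT) iC; exact.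
- by rewrite -restrict_EFin; apply/integrable_restrict => //; rewrite setTI.
- move=> w _; rewrite patchE /clamp; case: ifPn.
    rewrite inE /L/= in_itv/= => Yb.
    by rewrite lerB// le_max min_r// lexx orbT.
  rewrite notin_setE /L/= in_itv/= => /negP; rewrite -ltNge => Yb.
  by rewrite subr_le0 le_max le_min lexx (ltW Yb) orbT.
Qed.

(** Points of the rectangle outside A lie in {X >= t} \ A, those inside A in A n {Y <= 1 - t}; the
    two tail estimates bound these probabilities. The event A common to X and Y is what links the
    two variables here. *)
Lemma coherent_rectangle {d : measure_display} {T : measurableType d}
    {R : realType} {P : probability T R} {A : set T} {G H : set_system T}
    {X Y : {RV P >-> R}} (t : R) :
  measurable A -> is_cond_prob A G X -> is_cond_prob A H Y -> (t <= 1)%R ->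
  (fine (P (X @^-1` `[t, +oo[ `&` Y @^-1` `]-oo, 1 - t])) <=
   (1 - t) *
     (fine (P (X @^-1` `[t, +oo[)) + fine (P (Y @^-1` `]-oo, (1 - t)%R])))
   - (1 - t) + \int[P]_w clamp 0 (1 - t) (Y w)
   - \int[P]_w clamp 0 (1 - t) (X w - t))%R.
Proof.
move=> mA AX AY t1.
have b0 : (0 <= 1 - t)%R by rewrite subr_ge0.
have := cond_prob_upper_tail (1 - t) t AX b0.
have := cond_prob_lower_tail (1 - t) AY b0.
set U := X @^-1` _; set L := Y @^-1` _.
have mU : measurable U by exact: measurable_RV_preimage.
have mL : measurable L by exact: measurable_RV_preimage.
have mAL := measurableI _ _ mA mL; have mAU := measurableI _ _ mA mU.
have mUA := measurableD mU mA; have mUL := measurableI _ _ mU mL.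
have : (fine (P (U `&` L)) <= fine (P (U `\` A)) + fine (P (A `&` L)))%R.
  rewrite -fineD ?fin_num_measure// fine_le ?fin_num_measure//.
    by rewrite fin_numD !fin_num_measure.
  apply: (le_trans _ (measureU2 _ mUA mAL)).
  rewrite le_measure ?inE//; first exact: measurableU.
  by move=> w [Uw Lw]; have [Aw|nAw] := pselect (A w); [right|left].
have -> : fine (P (U `\` A)) = (fine (P U) - fine (P (A `&` U)))%R.
  rewrite measureD// ?(setIC U)// ?fineB// ?fin_num_measure//.
  by rewrite -ge0_fin_numE ?fin_num_measure.
by set EV := Rintegral _ _ _; set EW := Rintegral _ _ _; lra.
Qed.

(** * Tail functions and averaging over levels *)

Lemma measurable_upper_tail {d : measure_display} {T : measurableType d}
    {R : realType} (P : probability T R) (f : T -> R) (D : set R) :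
  measurable_fun [set: T] f -> measurable D ->
  measurable_fun D (fun t => P [set w | (t <= f w)%R]).
Proof.
move=> mf mD.
rewrite (_ : (fun _ => _) = EFin \o (fun t => fine (P [set w | (t <= f w)%R]))).
  apply/measurable_EFinP; apply: nonincreasing_measurable => // s t st.
  rewrite fine_le ?fin_num_measure ?le_measure ?inE//;
    try exact: measurable_ge_set.
  by move=> w /=; exact: le_trans.
apply/funext => t /=; rewrite fineK// fin_num_measure//.
exact: measurable_ge_set.
Qed.

Lemma layer_cake_clamp {d : measure_display} {T : measurableType d}
    {R : realType} (P : probability T R) (f : T -> R) (b : R) :
  measurable_fun [set: T] f -> (0 <= b)%R ->
  (\int[P]_w clamp 0 b (f w))%R%:E =
  \int[lebesgue_measure]_(t in `[0%R, b]) P [set w | (t <= f w)%R].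
Proof.
move=> mf b0.
have := layer_cake_poly P f 'X 0%R b mf b0; rewrite derivX => lc.
rewrite /Rintegral fineK.
  transitivity (\int[P]_w ('X.[clamp 0 b (f w)] - 'X.[0])%:E).
    by apply: eq_integral => w _; rewrite !hornerX subr0.
  rewrite lc => [|x _]; last by rewrite hornerC.
  by apply: eq_integral => t _; rewrite hornerC mul1e.
by apply: integrable_fin_num => //; exact: integrable_clamp.
Qed.

(** If P(f >= s) + P(g < s) >= b for all s in [0, b], integration over [0, b] makes the left side of
    the hypothesis at least b^2, by the layer-cake formula. *)
Lemma exists_crossing_level {d : measure_display} {T : measurableType d}
    {R : realType} (P : probability T R) (f g : T -> R) (b : R) :
  measurable_fun [set: T] f -> measurable_fun [set: T] g -> (0 <= b)%R ->
  (\int[P]_w clamp 0 b (f w) + (b - \int[P]_w clamp 0 b (g w)) < b ^+ 2)%R ->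
  exists s : R, (0 <= s <= b)%R /\
    (fine (P [set w | s <= f w]) + (1 - fine (P [set w | s <= g w])) < b)%R.
Proof.
move=> mf mg b0; apply: contraPP => /forallNP noS.
(* The complement P(g < s) is moved across the inequality, so that both integrands are sums of
   nonnegative terms and their integrals split. *)
have le_s s : `[0%R, b]%classic s ->
    b%:E + P [set w | (s <= g w)%R] <= P [set w | (s <= f w)%R] + 1.
  rewrite /= in_itv/= => sb; have := noS s.
  rewrite -(fineK (fin_num_measure P _ (measurable_ge_set s mf))).
  rewrite -(fineK (fin_num_measure P _ (measurable_ge_set s mg))).
  rewrite -!EFinD lee_fin => /not_andP[/(_ sb)//|/negP]; rewrite -leNgt.
  lra.
have mtf := measurable_upper_tail P f `[0%R, b]%classic mf (measurable_itv _).
have mtg := measurable_upper_tail P g `[0%R, b]%classic mg (measurable_itv _).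
have : \int[lebesgue_measure]_(s in `[0%R, b]) (b%:E + P [set w | (s <= g w)%R])
    <= \int[lebesgue_measure]_(s in `[0%R, b]) (P [set w | (s <= f w)%R] + 1).
  apply: ge0_le_integral => //.
  - by move=> s _; rewrite adde_ge0.
  - by apply: emeasurable_funD.
  - by apply: emeasurable_funD.
have eb : @lebesgue_measure R `[0%R, b] = b%:E.
  rewrite lebesgue_measure_itv/= lte_fin.
  case: ltP => [_|]; first by rewrite sube0.
  by move=> b_le0; congr EFin; apply/eqP; rewrite eq_le b0.
rewrite !ge0_integralD// -!layer_cake_clamp// !integral_cst//.
set m := (X in b%:E * X); set m' := (X in 1 * X).
have -> : m = b%:E := eb; have -> : m' = b%:E := eb.
rewrite mul1e -EFinM -!EFinD lee_fin expr2 => h.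
by apply/negP; rewrite -leNgt; lra.
Qed.

(** * The one-sided tail of X - Y *)

Lemma ae_subset_measure_le {d : measure_display} {T : measurableType d}
    {R : realType} (mu : {measure set T -> \bar R}) (B C : set T) :
  measurable B -> measurable C -> {ae mu, forall w, B w -> C w} ->
  mu B <= mu C.
Proof.
move=> mB mC [N [mN N0 BCN]].
have mCN : measurable (C `|` N) by exact: measurableU.
rewrite -[leRHS]adde0 -N0; apply: le_trans (measureU2 _ mC mN).
rewrite le_measure ?inE// => w Bw.
by have [Cw|nCw] := pselect (C w); [left|right; apply: BCN => /= /(_ Bw)].
Qed.

Lemma independent_fine {d : measure_display} {T : measurableType d}
    {R : realType} {P : probability T R} {X Y : {RV P >-> R}} (B C : set R) :
  independent_RV2 X Y -> measurable B -> measurable C ->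
  fine (P (X @^-1` B `&` Y @^-1` C)) =
  (fine (P (X @^-1` B)) * fine (P (Y @^-1` C)))%R.
Proof.
move=> XY mB mC; rewrite XY// fineM// fin_num_measure//;
exact: measurable_RV_preimage.
Qed.

Section difference_tail.
Context {d : measure_display} {T : measurableType d} {R : realType}.
Context {P : probability T R} {A : set T} {G H : set_system T}.
Context {X Y : {RV P >-> R}}.
Context (mA : measurable A) (AX : is_cond_prob A G X).
Context (AY : is_cond_prob A H Y) (XY : independent_RV2 X Y).

Let p (t : R) := fine (P (X @^-1` `[t, +oo[)).
Let q (s : R) := fine (P (Y @^-1` `]-oo, s])).

Let mpreX := measurable_RV_preimage X.
Let mpreY := measurable_RV_preimage Y.

Lemma measurable_diff_tail (t : R) : measurable [set w | (t <= X w - Y w)%R].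
Proof. by apply: measurable_ge_set; exact: measurable_funB. Qed.

(** Almost surely Y >= 0 and X <= 1, so X - Y >= t forces X >= t and Y <= 1 - t; independence
    factors this rectangle. *)
Lemma diff_tail_le_mul (t : R) :
  (fine (P [set w | (t <= X w - Y w)%R]) <= p t * q (1 - t))%R.
Proof.
have mI : measurable (`[t, +oo[%classic : set R) by exact: measurable_itv.
have mJ : measurable (`]-oo, (1 - t)%R]%classic : set R).
  exact: measurable_itv.
have mD := measurable_diff_tail t.
have mUL := measurableI _ _ (mpreX _ mI) (mpreY _ mJ).
rewrite -(independent_fine _ _ XY)// fine_le ?fin_num_measure//.
apply: ae_subset_measure_le => //.
apply: filterS2 (cond_prob_ge0_le1 mA AX) (cond_prob_ge0_le1 mA AY).
move=> w /andP[X0 X1] /andP[Y0 Y1] /= tXY; rewrite !in_itv/= andbT.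
by split; lra.
Qed.

(** The product bound settles the case where one factor is at most 1 - t. Otherwise a level s
    separates the event into two rectangles whose remaining factors sum to less than 1 - t. *)
Lemma diff_tail_le_max (t : R) : (t <= 1)%R ->
  (fine (P [set w | (t <= X w - Y w)%R]) <=
   (1 - t) * Num.max (p t) (q (1 - t)))%R.
Proof.
move=> t1; have b0 : (0 <= 1 - t)%R by rewrite subr_ge0.
have p0 : (0 <= p t)%R by exact: fine_ge0.
have q0 : (0 <= q (1 - t))%R by exact: fine_ge0.
have pM : (p t <= Num.max (p t) (q (1 - t)))%R by rewrite le_max lexx.
have qM : (q (1 - t) <= Num.max (p t) (q (1 - t)))%R.
  by rewrite le_max lexx orbT.
have [pb|pb] := leP (p t) (1 - t)%R.
  by apply: le_trans (diff_tail_le_mul t) _; apply: ler_pM.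
have [qb|qb] := leP (q (1 - t)%R) (1 - t)%R.
  apply: le_trans (diff_tail_le_mul t) _; rewrite mulrC; exact: ler_pM.
have mI (s : R) : measurable (`[s, +oo[%classic : set R).
  exact: measurable_itv.
have mJ (s : R) : measurable (`]-oo, s]%classic : set R).
  exact: measurable_itv.
have mK (s : R) : measurable (`]-oo, s[%classic : set R).
  exact: measurable_itv.
have mXt : measurable_fun [set: T] (fun w => X w - t)%R.
  exact: measurable_funB.
have mY : measurable_fun [set: T] Y by exact: measurable_funPT.
have rect := coherent_rectangle t mA AX AY t1.
rewrite (independent_fine _ _ XY)// -/(p t) -/(q (1 - t)%R) in rect.
have [|s [/andP[s0 sb] sum_lt]] :=
    @exists_crossing_level _ _ _ P _ _ _ mXt mY b0.
  (* With b = 1 - t, [rect] bounds the sum of the two truncated integrals by b (p + q) - p q = b^2 -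
     (p - b)(q - b), which is below b^2. *)
  have : (0 < (p t - (1 - t)) * (q (1 - t) - (1 - t)))%R.
    by rewrite mulr_gt0// subr_gt0.
  rewrite expr2; move: rect.
  by set EV := Rintegral _ _ _; set EW := Rintegral _ _ _; nra.
have eU : [set w | (s <= X w - t)%R] = X @^-1` `[(t + s)%R, +oo[.
  by apply/seteqP; split=> w /=; rewrite in_itv/= andbT lerBrDl.
have eL : (1 - fine (P [set w | (s <= Y w)%R]) =
    fine (P (Y @^-1` `]-oo, s[)))%R.
  have mYs := measurable_ge_set s mY.
  rewrite -[X in (X - _)%R]/(fine 1) -fineB// ?fin_num_measure//.
  rewrite -probability_setC//.
  congr (fine (P _)).
  by apply/seteqP; split=> w /=; rewrite in_itv/= ltNge => /negP.
rewrite eU eL in sum_lt.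
have mD := measurable_diff_tail t.
have mB1 := measurableI _ _ (mpreX _ (mI t)) (mpreY _ (mK s)).
have mB2 := measurableI _ _ (mpreX _ (mI (t + s)%R)) (mpreY _ (mJ (1 - t)%R)).
(* Split at Y = s: if Y < s, then X >= t still holds; if Y >= s, then X >= t + s, while Y <= 1 - t
   because X <= 1. *)
have : (fine (P [set w | (t <= X w - Y w)%R]) <=
    fine (P (X @^-1` `[t, +oo[ `&` Y @^-1` `]-oo, s[)) +
    fine (P (X @^-1` `[(t + s)%R, +oo[ `&` Y @^-1` `]-oo, (1 - t)%R])))%R.
  rewrite -fineD ?fin_num_measure// fine_le ?fin_num_measure//.
    by rewrite fin_numD !fin_num_measure.
  apply: le_trans (measureU2 _ mB1 mB2).
  apply: ae_subset_measure_le => //; first exact: measurableU.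
  apply: filterS2 (cond_prob_ge0_le1 mA AX) (cond_prob_ge0_le1 mA AY).
  move=> w /andP[X0 X1] /andP[Y0 Y1] /= tXY; rewrite !in_itv/= !andbT.
  by case: (ltP (Y w) s) => Ys; [left|right]; split => //; lra.
rewrite !(independent_fine _ _ XY)// -/(p t) -/(q (1 - t)%R) => Dle.
apply: le_trans Dle _.
have a0 : (0 <= fine (P (X @^-1` `[(t + s)%R, +oo[)))%R by exact: fine_ge0.
have c0 : (0 <= fine (P (Y @^-1` `]-oo, s[)))%R by exact: fine_ge0.
(* Each of p and q is replaced by their maximum M, so the sum is at most M times P(X >= t + s) + P(Y
   < s), hence at most M (1 - t). *)
have h1 := ler_wpM2r c0 pM.
have h2 := ler_wpM2l a0 qM.
have M0 := le_trans p0 pM.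
have h3 := ler_wpM2r M0 (ltW sum_lt).
by move: h1 h2 h3; rewrite mulrDl; lra.
Qed.

End difference_tail.

(** * Adding up the two one-sided tails *)

Lemma tail_pair_bound {R : realType} (b u v x y : R) :
  (0 <= b <= 1/2 -> 0 <= u <= 1 -> 0 <= v <= 1 ->
   x <= b * u -> x <= u * (1 - v) -> y <= b * v -> y <= v * (1 - u) ->
   x + y <= 2 * b * (1 - b))%R.
Proof.
move=> /andP[b0 b1] /andP[u0 u1] /andP[v0 v1] xb xu yb yv.
(* If both u, v <= 1 - b, the linear bounds suffice. If only v exceeds it, u (1 - v) + b v is
   largest at u = v = 1 - b, and symmetrically. If both do, u + v - 2uv decreases in each variable,
   since 1 - b >= 1/2. Every case ends at the extremal value 2b(1 - b). *)
have [ub|ub] := leP u (1 - b)%R; have [vb|vb] := leP v (1 - b)%R; nra.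
Qed.

(** Here p1, p0 stand for P(X >= t), P(X <= b), and q1, q0 for the same with Y; x and y are the
    tails of X - Y and Y - X. If the maxima are q0 and p0, or p1 and q1, the constraints turn the
    product bounds into those of [tail_pair_bound]. If both maxima belong to one variable, x + y <=
    b, and b <= 1/2 concludes. *)
Lemma coherent_tail_bound {R : realType} (b p1 p0 q1 q0 x y : R) :
  (0 <= b <= 1/2 -> 0 <= p1 -> 0 <= p0 -> 0 <= q1 -> 0 <= q0 ->
   p1 + p0 <= 1 -> q1 + q0 <= 1 ->
   x <= p1 * q0 -> x <= b * Num.max p1 q0 ->
   y <= q1 * p0 -> y <= b * Num.max q1 p0 ->
   x + y <= 2 * b * (1 - b))%R.
Proof.
move=> /andP[b0 b1] p10 p00 q10 q00 p_le1 q_le1 xp xb yq yb.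
have b_itv : (0 <= b <= 1/2)%R by rewrite b0.
have bb : (b <= 2 * b * (1 - b))%R by nra.
have bp := ler_wpM2l b0 p_le1; have bq := ler_wpM2l b0 q_le1.
have [h|h] := leP p1 q0; have [h'|h'] := leP q1 p0.
- rewrite max_r// in xb; rewrite max_r// in yb.
  by apply: (tail_pair_bound b q0 p0) => //; try (apply/andP; split); nra.
- rewrite max_r// in xb; rewrite (max_l (ltW h')) in yb; lra.
- rewrite (max_l (ltW h)) in xb; rewrite max_r// in yb; lra.
- rewrite (max_l (ltW h)) in xb; rewrite (max_l (ltW h')) in yb.
  by apply: (tail_pair_bound b p1 q1) => //; try (apply/andP; split); nra.
Qed.

Lemma coherent_independent_tail {d : measure_display} {T : measurableType d}
    {R : realType} {P : probability T R} {X Y : {RV P >-> R}} (t : R) :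
  coherent_independent X Y -> (1/2 < t <= 1)%R ->
  P [set w | (t <= `|X w - Y w|)%R] <= (2 * t * (1 - t))%:E.
Proof.
move=> [[A [G [H [mA _ _ AX AY]]]] XY] /andP[t2 t1].
have YX : independent_RV2 Y X by move=> B C mB mC; rewrite setIC XY// muleC.
(* Since t > 1/2, the events Z >= t and Z <= 1 - t are disjoint. *)
have disj (Z : {RV P >-> R}) : (fine (P (Z @^-1` `[t, +oo[)) +
    fine (P (Z @^-1` `]-oo, (1 - t)%R])) <= 1)%R.
  have mU : measurable (Z @^-1` `[t, +oo[).
    exact: measurable_RV_preimage.
  have mL : measurable (Z @^-1` `]-oo, (1 - t)%R]).
    exact: measurable_RV_preimage.
  rewrite -fineD ?fin_num_measure// -measureU//.
    rewrite -[leRHS]/(fine 1) fine_le ?fin_num_measure ?probability_le1//;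
      exact: measurableU.
  rewrite -subset0 => w [] /=; rewrite !in_itv/= andbT; lra.
have xm := diff_tail_le_mul mA AX AY XY t.
have xM := diff_tail_le_max mA AX AY XY t t1.
have ym := diff_tail_le_mul mA AY AX YX t.
have yM := diff_tail_le_max mA AY AX YX t t1.
have b_itv : (0 <= 1 - t <= 1/2)%R by apply/andP; split; lra.
have := coherent_tail_bound _ _ _ _ _ _ _ b_itv (fine_ge0 (measure_ge0 _ _))
  (fine_ge0 (measure_ge0 _ _)) (fine_ge0 (measure_ge0 _ _))
  (fine_ge0 (measure_ge0 _ _)) (disj X) (disj Y) xm xM ym yM.
have mX := measurable_diff_tail (X := X) (Y := Y) t.
have mY := measurable_diff_tail (X := Y) (Y := X) t.
have mXY : measurable [set w | (t <= `|X w - Y w|)%R].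
  apply: measurable_ge_set; apply: measurableT_comp => //.
  exact: measurable_funB.
move=> sum_le; apply: (@le_trans _ _
    (P [set w | (t <= X w - Y w)%R] + P [set w | (t <= Y w - X w)%R])).
  apply: le_trans (measureU2 _ mX mY).
  rewrite le_measure ?inE//; first exact: measurableU.
  by move=> w /=; rewrite ler_normr opprB => /orP.
rewrite -(fineK (fin_num_measure P _ mX)) -(fineK (fin_num_measure P _ mY)).
by rewrite -EFinD lee_fin; move: sum_le; lra.
Qed.

(** * The moment bound and its closed form *)

Lemma coherent_independent_moment {d : measure_display}
    {T : measurableType d} {R : realType} {P : probability T R}
    {X Y : {RV P >-> R}} (k : nat) :
  (0 < k)%N -> coherent_independent X Y ->
  'E_P[fun w => (`|X w - Y w| ^+ k)%R] <=
     \int[lebesgue_measure]_(t in `[0%R, (1 / 2)%R])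
        ((k%:R * t ^+ k.-1)%R : R)%:E
     + \int[lebesgue_measure]_(t in `[(1 / 2)%R, 1%R])
        ((k%:R * t ^+ k.-1 * (2 * t * (1 - t)))%R : R)%:E.
Proof.
move=> k0 XY; have [[A [G [H [mA _ _ AX AY]]]] _] := XY.
pose Z w := `|X w - Y w|%R.
have mZ : measurable_fun [set: T] Z.
  by apply: measurableT_comp => //; exact: measurable_funB.
have derivE' (t : R) : (('X^k)^`()).[t] = (k%:R * t ^+ k.-1)%R.
  by rewrite derivXn hornerMn hornerXn mulr_natl.
have deriv0 (t : R) : (0 <= t <= 1 -> 0 <= (('X^k)^`()).[t])%R.
  by move=> /andP[t0 _]; rewrite derivE' mulr_ge0// exprn_ge0.
have ge0 (t : R) : (0 <= t <= 1)%R ->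
    0 <= (('X^k)^`().[t])%:E * P [set w | (t <= Z w)%R].
  by move=> t01; rewrite mule_ge0// lee_fin deriv0.
(* Almost surely |X - Y| lies in [0, 1], so the truncation changes nothing, and 0^k = 0 because k >
   0. *)
have -> : 'E_P[fun w => (`|X w - Y w| ^+ k)%R] =
    \int[P]_w (('X^k).[clamp 0 1 (Z w)] - ('X^k).[0])%:E.
  rewrite unlock; apply: ge0_ae_eq_integral => //.
  - by apply/measurable_EFinP; apply: measurable_funX.
  - apply/measurable_EFinP; under eq_fun do rewrite !hornerXn.
    apply: measurable_funB => //; apply: measurable_funX.
    exact: measurable_clamp.
  - move=> w _; rewrite lee_fin !hornerXn expr0n gtn_eqF// subr0 exprn_ge0//.
    by have /andP[] := clamp_itv 0 1 (Z w) ler01.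
  apply: filterS2 (cond_prob_ge0_le1 mA AX) (cond_prob_ge0_le1 mA AY).
  move=> w /andP[X0 X1] /andP[Y0 Y1] _ /=.
  have Z1 : (Z w <= 1)%R by rewrite /Z ler_norml; apply/andP; split; lra.
  rewrite !hornerXn expr0n gtn_eqF// subr0 /clamp.
  by rewrite (min_r Z1) max_r ?normr_ge0.
rewrite layer_cake_poly//.
have mtail D := measurable_upper_tail P Z D mZ.
have mpoly (p : {poly R}) (D : set R) : measurable_fun D (fun t => p.[t]%:E).
  by apply/measurable_EFinP; exact: measurable_poly.
have mpow (D : set R) : measurable_fun D (fun t : R => (k%:R * t ^+ k.-1)%R).
  by apply: measurable_funM => //; exact: measurable_funX.
(* The tail bound holds for t > 1/2 only, so the point 1/2 goes to the left piece, where the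
   probability is bounded by 1. *)
have -> : `[0%R, 1%R]%classic = `[0%R, (1/2)%R] `|` `](1/2)%R, 1%R] :> set R.
  by rewrite -itv_bndbnd_setU// bnd_simp; lra.
rewrite ge0_integral_setU//=; last 3 first.
- apply: emeasurable_funM; first exact: mpoly.
  by apply: mtail; exact: measurableU.
- by move=> t []/=; rewrite in_itv/= => /andP[h1 h2];
    apply: ge0; apply/andP; split; lra.
- apply/disj_setPS => t [] /=; rewrite !in_itv/=; lra.
apply: leeD.
  apply: ge0_le_integral => //.
  - move=> t; rewrite /= in_itv/= => /andP[h1 h2].
    apply: ge0; apply/andP; split; lra.
  - by apply: emeasurable_funM; [exact: mpoly|exact: mtail].
  - by apply/measurable_EFinP; exact: mpow.
  - move=> t; rewrite /= in_itv/= => /andP[h1 h2].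
    rewrite -derivE' -[leRHS]mule1 lee_wpmul2l ?probability_le1//.
      by rewrite lee_fin deriv0//; apply/andP; split; lra.
    exact: measurable_ge_set.
have mbound (D : set R) : measurable_fun D
    (fun t : R => (k%:R * t ^+ k.-1 * (2 * t * (1 - t)))%:E).
  apply/measurable_EFinP.
  apply: measurable_funM; first exact: mpow.
  by apply: measurable_funM; [exact: measurable_funM|exact: measurable_funB].
rewrite -[leRHS]integral_itv_obnd_cbnd//.
apply: ge0_le_integral => //.
- move=> t; rewrite /= in_itv/= => /andP[h1 h2].
  apply: ge0; apply/andP; split; lra.
- by apply: emeasurable_funM; [exact: mpoly|exact: mtail].
- exact: mbound.
- move=> t; rewrite /= in_itv/= => t_itv.
  rewrite -derivE' EFinM lee_wpmul2l ?coherent_independent_tail//.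
  rewrite lee_fin deriv0//.
  by move/andP: t_itv => [h1 h2]; apply/andP; split; lra.
Qed.

Lemma moment_bound_closed_form (R : realType) (k : nat) : (0 < k)%N ->
  \int[lebesgue_measure]_(t in `[0%R, (1 / 2)%R])
        ((k%:R * t ^+ k.-1)%R : R)%:E
     + \int[lebesgue_measure]_(t in `[(1 / 2)%R, 1%R])
        ((k%:R * t ^+ k.-1 * (2 * t * (1 - t)))%R : R)%:E =
  (2 * (k%:R / ((k%:R + 1) * (k%:R + 2))) + 2 ^- k
      - 2 ^- k.+1 * ((k%:R * (k%:R + 3)) / ((k%:R + 1) * (k%:R + 2))))%R%:E.
Proof.
case: k => // n _.
(* With k = n + 1, [F] is an antiderivative of k t^(k-1) 2t(1 - t) = 2k t^k - 2k t^(k+1). *)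
pose a : R := (n.+1%:R / n.+2%:R)%R; pose b : R := (n.+1%:R / n.+3%:R)%R.
pose F : {poly R} := ((2 * a) *: 'X^(n.+2) - (2 * b) *: 'X^(n.+3))%R.
have n0 := ler0n R n.
have dXn (m : nat) (t : R) : (('X^(m.+1))^`()).[t] = (m.+1%:R * t ^+ m)%R.
  by rewrite derivXn hornerMn hornerXn mulr_natl.
rewrite [X in X + _](_ : _ = ('X^(n.+1).[1/2] - 'X^(n.+1).[0])%:E); last first.
  rewrite -integral_deriv_poly; last lra.
  by apply: eq_integral => t _; rewrite dXn.
rewrite [X in _ + X](_ : _ = (F.[1] - F.[1/2])%:E); last first.
  rewrite -integral_deriv_poly; last lra.
  apply: eq_integral => t _; congr EFin.
  rewrite /F derivB !derivZ hornerD hornerN !hornerZ !dXn !exprS /a /b.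
  by field; rewrite !gt_eqF//; lra.
rewrite -EFinD; congr EFin.
rewrite /F !(hornerD, hornerN, hornerZ, hornerXn) !expr1n expr0n/=.
rewrite !div1r /a /b -!exprVn !exprS.
by field; rewrite !gt_eqF//; lra.
Qed.

Theorem corollary5p1 (R : realType) (k : nat) (hk : (3 <= k)%N) :
  (ereal_sup (coherent_independent_moments R k) <=
     \int[lebesgue_measure]_(t in `[0%R, (1 / 2)%R])
        ((k%:R * t ^+ k.-1)%R : R)%:E
     + \int[lebesgue_measure]_(t in `[(1 / 2)%R, 1%R])
        ((k%:R * t ^+ k.-1 * (2 * t * (1 - t)))%R : R)%:E)
  /\
  (ereal_sup (coherent_independent_moments R k) <=
     (2 * (k%:R / ((k%:R + 1) * (k%:R + 2))) + 2 ^- k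
      - 2 ^- k.+1 * ((k%:R * (k%:R + 3)) / ((k%:R + 1) * (k%:R + 2))))%R%:E).
Proof.
have k0 : (0 < k)%N by exact: leq_trans hk.
(* Both right-hand sides are the same number, so one bound on every element of the set proves the
   two conjuncts. *)
rewrite -moment_bound_closed_form//.
by split; apply: ge_ereal_sup => _ [d [T [P [X [Y [XY ->]]]]]];
  exact: coherent_independent_moment.
Qed.
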